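(* Let $G=\{G^L\mid S(G)\mid G^R\}\in\mathbb{CR}$ have $m$ Left moves and $n$ Right moves. Let $H$ be the game obtained from $G$ by deleting the (Right) move $G(\cdot,n)$. If, in $G$, for every $i$ there exists $j_i\neq n$ such that $G^{i,n}\succeq G^{i,j_i}$, then $G=H$.
   Context: Short cr-games (Cheating Robot games). The set $\mathbb{CR}$ of short cr-games (positions) is defined recursively. A position $G$ consists of a finite list $G(L)$ of $m\ge 0$ Left moves $G(i,\cdot)$, a finite list $G(R)$ of $n\ge 0$ Right moves $G(\cdot,j)$, and, for each $i$ a Left option $G^{i,\cdot}$, for each $j$ a Right option $G^{\cdot,j}$, and for each pair $(i,j)$ a same-round option $G^{i,j}$, all options being previously constructed positions. One writes $G=\{G^L\mid S(G)\mid G^R\}$, where $G^L$, $G^R$ are the lists of Left and Right options and $S(G)$ is the $m\times n$ matrix with entries $G^{i,j}$ ($S(G)=\emptyset$ if $m=0$ or $n=0$). The base case is $0=\{\,\cdot\mid\cdot\mid\cdot\,\}$ (no moves); a dot denotes an empty list. Deleting Right's move $G(\cdot,n)$ means deleting that move together with its Right option $G^{\cdot,n}$ and all same-round options $G^{i,n}$, leaving everything else unchanged. Outcomes. Play proceeds in rounds: from $G$, Left chooses a move $G(i,\cdot)$; then Right, knowing Left's choice, chooses $G(\cdot,j)$; the new position is $G^{i,j}$. If $S(G)=\emptyset$: $o(G)=\mathcal L$ (Left wins) if $G(L)\ne\emptyset$; $o(G)=\mathcal R$ (Right wins) if $G(R)\neq\emptyset$; otherwise $o(G)=\mathcal D$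 (draw). If $S(G)\ne\emptyset$: $o(G)=\mathcal L$ if Left can force a win, $o(G)=\mathcal R$ if Right can force a win, otherwise $o(G)=\mathcal D$. Outcomes are totally ordered by $\mathcal L>\mathcal D>\mathcal R$. Disjunctive sum. $G+H$ has Left moves $G(i,\cdot)+H$ and $G+H(k,\cdot)$ with Left options $G^{i,\cdot}+H$ and $G+H^{k,\cdot}$; Right moves $G(\cdot,j)+H$ and $G+H(\cdot,l)$ with Right options $G^{\cdot,j}+H$ and $G+H^{\cdot,l}$; and same-round options $G^{i,j}+H$ (both move in $G$), $G+H^{k,l}$ (both move in $H$), $G^{i,\cdot}+H^{\cdot,l}$ (Left in $G$, Right in $H$), $G^{\cdot,j}+H^{k,\cdot}$ (Left in $H$, Right in $G$). Equality and order. For $G,H\in\mathbb{CR}$: $G=H$ if $o(G+X)=o(H+X)$ for all $X\in\mathbb{CR}$; $G\succeq H$ if $o(G+X)\ge o(H+X)$ for all $X\in\mathbb{CR}$.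
   Formalization: ''For every i'' also includes the dot row: some j ≠ n must satisfy G^{·,n} ⪰ G^{·,j}. With i ranging only over Left moves the claim fails, e.g. G = {·|·|0}, H = 0, where o(G) = R but o(H) = D. *)

(* Defs.v *)
From mathcomp Require Import all_boot.

Set Implicit Arguments.
Unset Strict Implicit.
Unset Printing Implicit Defensive.

(* Finite lists of options are functions on ordinals, 'I_k standing for the
   k moves 1, ..., k.  [GS i j] is the entry of the matrix S(G); it carries no
   data when m = 0 or n = 0, which is the convention S(G) = empty. *)
Inductive crgame : Type :=
  Game (m n : nat) (GL : 'I_m -> crgame) (GR : 'I_n -> crgame)
       (GS : 'I_m -> 'I_n -> crgame).

Declare Scope crgame_scope.
Delimit Scope crgame_scope with cr.
Bind Scope crgame_scope with crgame.

(* The order of quantifiers reflects that Right moves knowing Left's choice.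
   The matrix is empty iff m = 0 or n = 0; play then stops, and Left wins iff
   Left still has a move. *)
Fixpoint left_wins (G : crgame) : bool :=
  let: Game m n _ _ GS := G in
  if (m == 0) || (n == 0) then m != 0
  else [exists i, [forall j, left_wins (GS i j)]].

Fixpoint right_wins (G : crgame) : bool :=
  let: Game m n _ _ GS := G in
  if (m == 0) || (n == 0) then n != 0
  else [forall i, [exists j, right_wins (GS i j)]].

Variant outcome : Type := OutL | OutD | OutR.

Definition outcome_rank (o : outcome) : nat :=
  match o with OutL => 2 | OutD => 1 | OutR => 0 end.

Definition outcome_ge (o1 o2 : outcome) : bool :=
  outcome_rank o2 <= outcome_rank o1.

Definition out (G : crgame) : outcome :=
  if left_wins G then OutL else if right_wins G then OutR else OutD.

(* Moves of the sum are the moves of G followed by the moves of H. *)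
Fixpoint gadd (G : crgame) : crgame -> crgame :=
  match G with
  | Game m n GL GR GS =>
    fix gaddG (H : crgame) : crgame :=
      match H with
      | Game p q HL HR HS =>
        @Game (m + p) (n + q)
          (fun a => match split a with
                    | inl i => gadd (GL i) H
                    | inr k => gaddG (HL k)
                    end)
          (fun b => match split b with
                    | inl j => gadd (GR j) H
                    | inr l => gaddG (HR l)
                    end)
          (fun a b => match split a, split b with
                      | inl i, inl j => gadd (GS i j) H
                      | inr k, inr l => gaddG (HS k l)
                      | inl i, inr l => gadd (GL i) (HR l)
                      | inr k, inl j => gadd (GR j) (HL k)
                      end)
      end
  end.

Notation "G + H" := (gadd G H) : crgame_scope.

Definition game_eq (G H : crgame) : Prop :=
  forall X : crgame, out (G + X)%cr = out (H + X)%cr.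

Definition game_ge (G H : crgame) : Prop :=
  forall X : crgame, outcome_ge (out (G + X)%cr) (out (H + X)%cr).

(* G^{i,j} where the row index may be the dot: [None] is the dot, giving the
   Right option G^{.,j}, and [Some i] gives the same-round option G^{i,j}.
   The dot row is what Right's j-th move yields in a sum when Left moves in
   another component, so domination of Right moves has to compare it too:
   without it, { . | . | 0 } would equal 0 vacuously. *)
Definition opt (m n : nat) (GR : 'I_n -> crgame) (GS : 'I_m -> 'I_n -> crgame)
    (i : option 'I_m) (j : 'I_n) : crgame :=
  if i is Some i' then GS i' j else GR j.

(* [lift j0] enumerates in order the indices other than [j0]. *)
Definition delete_right (m n : nat) (GL : 'I_m -> crgame)
    (GR : 'I_n.+1 -> crgame) (GS : 'I_m -> 'I_n.+1 -> crgame)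
    (j0 : 'I_n.+1) : crgame :=
  Game GL (fun j => GR (lift j0 j)) (fun i j => GS i (lift j0 j)).

(* Main.v *)
Require Import Defs.
From mathcomp Require Import all_boot.

(** Induct on the test game X, comparing G + X and H + X round by round, where
    H is G without Right's move j0.  Fix Left's choice in the round; it
    determines which row of options Right picks from.

    If Left moves in G, Right may answer in G, reaching G^{i,j} + X, or in X,
    reaching the same position from G + X as from H + X.  If Left moves in X,
    Right may answer in G, reaching G^{.,j} + X^{k,.}, or in X, where the
    induction hypothesis applies to G + X^{k,l} and H + X^{k,l}.  In both cases
    the only choice that H takes away is j0, and the domination hypothesis,
    tested against X or X^{k,.}, says that some other answer j of Right in the
    same row is at least as good for Right ([forall_split_delete],
    [exists_split_delete]).  So every row has the same value in both sums.

    Domination of the dot row provides a Right move other than j0, so H still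
    has a Right move, and play stops in G + X exactly when it stops in H + X.

    Domination compares outcomes, whereas the induction follows the two winning
    predicates separately; the translation between them ([game_ge_left_wins],
    [game_ge_right_wins]) rests on the fact that the players cannot both have a
    winning strategy ([right_wins_not_left]). *)

Lemma right_wins_not_left (G : crgame) : right_wins G -> ~~ left_wins G.
Proof.
elim: G => m n GL _ GR _ GS IH /=.
case: ifP => [|_ /forallP rG].
  by case: (m == 0) => //= ->.
apply/existsPn => i; apply/forallPn.
by have /existsP[j rGij] := rG i; exists j; apply: IH.
Qed.

Lemma game_ge_left_wins (A B X : crgame) :
  game_ge A B -> left_wins (B + X)%cr -> left_wins (A + X)%cr.
Proof.
move=> /(_ X); rewrite /out => + lB; rewrite lB.
by case: (left_wins (A + X)) => //; case: ifP.
Qed.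

Lemma game_ge_right_wins (A B X : crgame) :
  game_ge A B -> right_wins (A + X)%cr -> right_wins (B + X)%cr.
Proof.
move=> /(_ X); rewrite /out => + rA; rewrite rA (negPf (right_wins_not_left _ rA)).
by case: (left_wins (B + X)) => //; case: ifP.
Qed.

(** In a sum, Right's answers to a fixed choice of Left lead to positions [A]
    when they are made in the first component and [B] when they are made in the
    second.  Taking away the answer [j0] does not change whether all of them
    satisfy [w], as [j] imposes the stronger condition and remains.  The
    positions [C] replace [B] because, when both players move in the second
    component, the first one is left over with [j0] deleted. *)
Lemma forall_split_delete (T : Type) (w : pred T) (n q : nat)
    (j0 j : 'I_n.+1) (A : 'I_n.+1 -> T) (B C : 'I_q -> T) :
  j != j0 -> (w (A j) -> w (A j0)) -> (forall l, w (B l) = w (C l)) ->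
  [forall b, w match split b with inl k => A k | inr l => B l end]
  = [forall b, w match split b with
                 | inl k => A (lift j0 k)
                 | inr l => C l
                 end].
Proof.
move=> jj0 wA wBC; apply/forallP/forallP => [allA b | allC b].
  case: (split b) => [k|l].
    by have := allA (unsplit (inl (lift j0 k))); rewrite unsplitK.
  by have := allA (unsplit (inr l)); rewrite unsplitK wBC.
have wlift k : w (A (lift j0 k)).
  by have := allC (unsplit (inl k)); rewrite unsplitK.
case: (split b) => [k|l].
  case: (unliftP j0 k) => [k' ->|->]; first exact: wlift.
  apply: wA; case: (unliftP j0 j) => [k' ->|jE]; first exact: wlift.
  by rewrite jE eqxx in jj0.
by have := allC (unsplit (inr l)); rewrite unsplitK wBC.
Qed.

Lemma exists_split_delete (T : Type) (w : pred T) (n q : nat)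
    (j0 j : 'I_n.+1) (A : 'I_n.+1 -> T) (B C : 'I_q -> T) :
  j != j0 -> (w (A j0) -> w (A j)) -> (forall l, w (B l) = w (C l)) ->
  [exists b, w match split b with inl k => A k | inr l => B l end]
  = [exists b, w match split b with
                 | inl k => A (lift j0 k)
                 | inr l => C l
                 end].
Proof.
move=> jj0 wA wBC; apply: negb_inj; rewrite !negb_exists.
apply: (forall_split_delete _ (predC w) _ _ _ _ A B C jj0) => [|l] /=.
  exact: contra.
by rewrite wBC.
Qed.

(** The two halves of the conclusion are kept apart from [out] because the
    round recursion, hence the induction on the test game, treats the two
    winning predicates separately. *)
Lemma wins_delete_right (m n : nat) (GL : 'I_m -> crgame)
    (GR : 'I_n.+1 -> crgame) (GS : 'I_m -> 'I_n.+1 -> crgame) (j0 : 'I_n.+1)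
    (Hdom : forall i : option 'I_m, exists2 j : 'I_n.+1, j != j0
              & game_ge (opt GR GS i j0) (opt GR GS i j))
    (G := Game GL GR GS) (H := delete_right GL GR GS j0) (X : crgame) :
  left_wins (G + X)%cr = left_wins (H + X)%cr
  /\ right_wins (G + X)%cr = right_wins (H + X)%cr.
Proof.
(* H still has a Right move, so the matrices of G + X and H + X are empty
   together. *)
have n_gt0 : 0 < n.
  have [j jj0 _] := Hdom None.
  case: (unliftP j0 j) => [[k lt_kn] _|jE]; first exact: leq_ltn_trans lt_kn.
  by rewrite jE eqxx in jj0.
elim: X => p q XL _ XR _ XS IH.
have nq0 : (n + q == 0) = false by rewrite addn_eq0 eqn0Ngt n_gt0.
split; rewrite /= nq0 orbF; case: ifP => [mp0|_]; rewrite ?(eqP mp0) //.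
- apply: eq_existsb => a; case: (split a) => [i|k].
  + have [j jj0 ge_j] := Hdom (Some i).
    apply: (forall_split_delete _ left_wins _ _ _ _
              (fun j => gadd (GS i j) (Game XL XR XS)) _ _ jj0) => //.
    exact: game_ge_left_wins ge_j.
  + have [j jj0 ge_j] := Hdom None.
    apply: (forall_split_delete _ left_wins _ _ _ _
              (fun j => gadd (GR j) (XL k)) _ _ jj0) => [|l].
      exact: game_ge_left_wins ge_j.
    by have [] := IH k l.
- apply: eq_forallb => a; case: (split a) => [i|k].
  + have [j jj0 ge_j] := Hdom (Some i).
    apply: (exists_split_delete _ right_wins _ _ _ _
              (fun j => gadd (GS i j) (Game XL XR XS)) _ _ jj0) => //.
    exact: game_ge_right_wins ge_j.
  + have [j jj0 ge_j] := Hdom None.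
    apply: (exists_split_delete _ right_wins _ _ _ _
              (fun j => gadd (GR j) (XL k)) _ _ jj0) => [|l].
      exact: game_ge_right_wins ge_j.
    by have [] := IH k l.
Qed.

Theorem theorem6 (m n : nat) (GL : 'I_m -> crgame) (GR : 'I_n.+1 -> crgame)
    (GS : 'I_m -> 'I_n.+1 -> crgame)
    (Hdom : forall i : option 'I_m, exists2 j : 'I_n.+1, j != ord_max
              & game_ge (opt GR GS i ord_max) (opt GR GS i j)) :
  game_eq (Game GL GR GS) (delete_right GL GR GS ord_max).
Proof.
move=> X; rewrite /out.
by have [-> ->] := wins_delete_right _ _ GL GR GS ord_max Hdom X.
Qed.
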